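(* For every positive integer $N$, let $E_N$ denote the $N\times N$ identity matrix and let $H_N$ be the real $N\times N$ matrix whose $(m,k)$-entry is $\frac{1}{\pi}\frac{1}{m-k}$ if $m\neq k$ and $0$ if $m=k$. Then $$\operatorname{cond}_2\bigl(E_N-iH_N\bigr)\le 2N-1,$$ and, for every real $\epsilon>0$, $$\operatorname{cond}_2\bigl[(1+\epsilon)E_N-iH_N\bigr]\le \frac{2+\epsilon-\tfrac1N}{\epsilon+\tfrac1N}\le\frac{2+\epsilon}{\epsilon}.$$ In particular, the condition number for $\epsilon=0$ grows at most linearly in $N$, and for each fixed $\epsilon>0$ it is bounded uniformly in $N$.
   Context: Here $i$ is the imaginary unit. For an invertible matrix $A\in\mathbb{C}^{N\times N}$, $\operatorname{cond}_2(A)=\|A\|_2\,\|A^{-1}\|_2$, where $\|\cdot\|_2$ is the operator norm induced by the Euclidean ($\ell^2$) norm on $\mathbb{C}^N$. *)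

(* Defs.v *)
From HB Require Import structures.
From mathcomp Require Import all_boot all_order all_algebra.
From mathcomp Require Import complex.
From mathcomp Require Import all_classical all_reals all_analysis.

Set Implicit Arguments.
Unset Strict Implicit.
Unset Printing Implicit Defensive.

Import Order.TTheory GRing.Theory Num.Theory.

Local Open Scope classical_set_scope.
Local Open Scope ring_scope.
Local Open Scope complex_scope.

(* The norm the library puts on matrices is the entrywise maximum norm, so the
   Euclidean norm and the operator norm it induces are defined here. *)
Definition l2norm (R : realType) (N : nat) (x : 'cV[R[i]]_N) : R :=
  Num.sqrt (\sum_(j < N) Normc.normc (x j 0) ^+ 2).

(* For N = 0 there is no unit vector and the supremum is the default value 0. *)
Definition opnorm2 (R : realType) (N : nat) (A : 'M[R[i]]_N) : R :=
  sup [set l2norm (A *m x) | x in [set x : 'cV[R[i]]_N | l2norm x = 1]].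

(* Meaningful only for A \in unitmx, since invmx A = A otherwise. *)
Definition cond2 (R : realType) (N : nat) (A : 'M[R[i]]_N) : R :=
  opnorm2 A * opnorm2 (invmx A).

(* Row and column indices start at 0; the entries only depend on m - k. *)
Definition hilbertmx (R : realType) (N : nat) : 'M[R]_N :=
  \matrix_(m < N, k < N)
    if m == k then 0 else pi^-1 * (m%:R - k%:R)^-1.

(* c E_N - i H_N *)
Definition shifted_hilbertmx (R : realType) (N : nat) (c : R) : 'M[R[i]]_N :=
  (c%:C)%:M - (0 +i* 1) *: map_mx (real_complex R) (hilbertmx R N).

(* Main.v *)
Require Import Defs.
From HB Require Import structures.
From mathcomp Require Import all_boot all_order all_algebra.
From mathcomp Require Import complex.
From mathcomp Require Import all_classical all_reals all_analysis.
From mathcomp Require Import ring lra.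
Import Order.TTheory GRing.Theory Num.Theory.
Import numFieldNormedType.Exports.
Local Open Scope ring_scope.

(** Since H is real and antisymmetric, -iH is Hermitian, and everything follows
    from |<x, -iHx>| <= (1 - 1/N) |x|^2: then c - iH lies between c - (1 - 1/N)
    and c + (1 - 1/N).  For x = u + iv let p(t) = \sum_m (u_m - i v_m) e^(imt)
    and let F be an antiderivative of |p|^2.  F is nondecreasing, so the mean of
    F(2 pi) - F(2 pi j / N) over j = 1, ..., N is nonnegative.  Frequencies
    0 < |m - k| < N average to zero over the N-th roots of unity, so this mean is
    pi ((1 - 1/N) |x|^2 + <x, -iHx>).  Exchanging u and v gives the other sign. *)

(** * Derivatives and sums of sines and cosines at equally spaced points *)

Section TrigonometricSums.
Variable R : realType.
Implicit Types (a t : R).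

Lemma is_derive_sin_scale a t :
  is_derive t 1 (fun x => sin (a * x)) (a * cos (a * t)).
Proof.
have h : is_derive t 1 (fun x => a * x) a.
  by apply: is_derive_eq; rewrite /GRing.scale /= mulr1.
have := @is_derive1_comp _ sin (fun x => a * x) t _ _ (is_derive_sin _) h.
by rewrite mulrC.
Qed.

Lemma is_derive_cos_scale a t :
  is_derive t 1 (fun x => cos (a * x)) (- (a * sin (a * t))).
Proof.
have h : is_derive t 1 (fun x => a * x) a.
  by apply: is_derive_eq; rewrite /GRing.scale /= mulr1.
have := @is_derive1_comp _ cos (fun x => a * x) t _ _ (is_derive_cos _) h.
by rewrite mulNr mulrC.
Qed.

Lemma is_derive_bigsum n (h : 'I_n -> R -> R) (dh : 'I_n -> R) t :
  (forall i, is_derive t 1 (h i) (dh i)) ->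
  is_derive t 1 (fun x => \sum_(i < n) h i x) (\sum_(i < n) dh i).
Proof.
move=> hd.
suff -> : (fun x => \sum_(i < n) h i x) = \sum_(i < n) h i by exact: is_derive_sum.
by apply/funext => x; rewrite fct_sumE.
Qed.

Lemma cos_nat2pi n : cos (n%:R * (2 * pi)) = 1 :> R.
Proof.
rewrite mulr_natl -[X in cos X]add0r (periodicn (_ : periodic cos (2 * pi))) ?cos0//.
by move=> x; rewrite mulr_natl cosD2pi.
Qed.

Lemma sin_nat2pi n : sin (n%:R * (2 * pi)) = 0 :> R.
Proof.
rewrite mulr_natl -[X in sin X]add0r (periodicn (_ : periodic sin (2 * pi))) ?sin0//.
by move=> x; rewrite mulr_natl sinD2pi.
Qed.

Lemma cos_natB2pi m k t : cos ((m%:R - k%:R) * (2 * pi) + t) = cos t :> R.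
Proof. by rewrite mulrBl cosD cosB sinB !cos_nat2pi !sin_nat2pi; ring. Qed.

Lemma sin_natB2pi m k t : sin ((m%:R - k%:R) * (2 * pi) + t) = sin t :> R.
Proof. by rewrite mulrBl sinD cosB sinB !cos_nat2pi !sin_nat2pi; ring. Qed.

(** Since [0 < |m - k| < N], the angle lies strictly between [-pi] and [pi] and is nonzero. This
    sine is the factor that makes the sums below telescope, so it must be cancellable. *)
Lemma sin_half_angle_neq0 (N m k : nat) : (m < N)%N -> (k < N)%N -> m != k ->
  sin ((m%:R - k%:R) * pi / N%:R) != 0 :> R.
Proof.
wlog km : m k / (k < m)%N => [wl mN kN neq|mN _ _].
  case: (ltngtP m k) neq => // [mk|km] _; last by apply: wl; rewrite // gtn_eqF.
  rewrite -oppr_eq0 -sinN -!mulNr opprB; apply: wl => //.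
  by rewrite gtn_eqF.
have N0 : 0 < N%:R :> R by rewrite ltr0n (leq_trans _ mN).
apply/lt0r_neq0/sin_gt0_pi.
have pi0 := pi_gt0 R.
rewrite divr_gt0 ?mulr_gt0 ?subr_gt0 ?ltr_nat//=.
rewrite ltr_pdivrMr// mulrC ltr_pM2l//.
by rewrite ltrBlDr -natrD ltr_nat ltn_addr.
Qed.

Lemma sum_cos_roots (N m k : nat) : (m < N)%N -> (k < N)%N -> m != k ->
  \sum_(j < N) cos ((m%:R - k%:R) * (2 * pi * j.+1%:R / N%:R)) = 0 :> R.
Proof.
move=> mN kN neq; apply: (mulfI (sin_half_angle_neq0 _ _ _ mN kN neq)).
have N0 : N%:R != 0 :> R by rewrite pnatr_eq0 -lt0n (leq_trans _ mN).
rewrite mulr0 mulr_sumr; set a := (m%:R - k%:R) * pi / N%:R.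
(* Product-to-sum formula: the summand becomes a difference of consecutive values of [F] below. The
   two end values differ by a shift of [(m - k) 2 pi], hence agree. *)
have E j : sin a * cos ((m%:R - k%:R) * (2 * pi * j.+1%:R / N%:R)) =
    2^-1 * sin (j.+1%:R * (2 * a) + a) - 2^-1 * sin (j%:R * (2 * a) + a).
  have -> : (m%:R - k%:R) * (2 * pi * j.+1%:R / N%:R) = j.+1%:R * (2 * a).
    by rewrite /a; field.
  have -> : j%:R * (2 * a) + a = j.+1%:R * (2 * a) - a by rewrite -natr1; ring.
  by rewrite sinD sinB; field.
pose F j := 2^-1 * sin (j%:R * (2 * a) + a).
transitivity (\sum_(0 <= j < N) (F j.+1 - F j)).
  by rewrite big_mkord; apply: eq_bigr => j _; exact: E.
rewrite telescope_sumr// /F.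
have -> : N%:R * (2 * a) = (m%:R - k%:R) * (2 * pi) by rewrite /a; field.
by rewrite sin_natB2pi mul0r add0r subrr.
Qed.

(** Equal indices are allowed here, as every summand is then [sin 0]. Otherwise the telescoping runs
    through cosines. *)
Lemma sum_sin_roots (N m k : nat) : (m < N)%N -> (k < N)%N ->
  \sum_(j < N) sin ((m%:R - k%:R) * (2 * pi * j.+1%:R / N%:R)) = 0 :> R.
Proof.
move=> mN kN; have [->|neq] := eqVneq m k.
  by rewrite big1// => j _; rewrite subrr mul0r sin0.
apply: (mulfI (sin_half_angle_neq0 _ _ _ mN kN neq)).
have N0 : N%:R != 0 :> R by rewrite pnatr_eq0 -lt0n (leq_trans _ mN).
rewrite mulr0 mulr_sumr; set a := (m%:R - k%:R) * pi / N%:R.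
have E j : sin a * sin ((m%:R - k%:R) * (2 * pi * j.+1%:R / N%:R)) =
    - (2^-1 * cos (j.+1%:R * (2 * a) + a)) + 2^-1 * cos (j%:R * (2 * a) + a).
  have -> : (m%:R - k%:R) * (2 * pi * j.+1%:R / N%:R) = j.+1%:R * (2 * a).
    by rewrite /a; field.
  have -> : j%:R * (2 * a) + a = j.+1%:R * (2 * a) - a by rewrite -natr1; ring.
  by rewrite cosD cosB; field.
pose F j := - (2^-1 * cos (j%:R * (2 * a) + a)).
transitivity (\sum_(0 <= j < N) (F j.+1 - F j)).
  by rewrite big_mkord; apply: eq_bigr => j _; rewrite /F opprK; exact: E.
rewrite telescope_sumr// /F.
have -> : N%:R * (2 * a) = (m%:R - k%:R) * (2 * pi) by rewrite /a; field.
by rewrite cos_natB2pi mul0r add0r subrr.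
Qed.

End TrigonometricSums.

(** * Bounds on the bilinear form of the Hilbert matrix *)

Section HilbertForm.
Variables (R : realType) (N : nat).
Implicit Types u v : 'I_N -> R.

Lemma hilbert_form_anti u v :
  \sum_m \sum_k v m * hilbertmx R N m k * u k =
  - \sum_m \sum_k u m * hilbertmx R N m k * v k.
Proof.
rewrite exchange_big -sumrN; apply: eq_bigr => m _.
rewrite -sumrN; apply: eq_bigr => k _; rewrite !mxE eq_sym.
case: ifP => _; first by ring.
by rewrite -opprB invrN; ring.
Qed.

(* The sum of these terms is an antiderivative of [|p t|^2] for the trigonometric
   polynomial [p t = \sum_m (u m - 'i v m) e^('i m t)]; on the diagonal the last
   two summands vanish because [0^-1 = 0]. *)
Definition energy_term u v (m k : 'I_N) (t : R) : R :=
  (m == k)%:R * (u m ^+ 2 + v m ^+ 2) * t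
  + (u m * u k + v m * v k) * (m%:R - k%:R)^-1 * sin ((m%:R - k%:R) * t)
  + (u m * v k - v m * u k) * (m%:R - k%:R)^-1 * cos ((m%:R - k%:R) * t).

Definition energy u v (t : R) : R :=
  \sum_(m < N) \sum_(k < N) energy_term u v m k t.

Lemma is_derive_energy_term u v (m k : 'I_N) (t : R) :
  is_derive t 1 (energy_term u v m k)
    ((u m * u k + v m * v k) * cos ((m%:R - k%:R) * t)
     - (u m * v k - v m * u k) * sin ((m%:R - k%:R) * t)).
Proof.
rewrite /energy_term.
have dsin := is_derive_sin_scale R (m%:R - k%:R) t.
have dcos := is_derive_cos_scale R (m%:R - k%:R) t.
apply: is_derive_eq; rewrite /GRing.scale /=.
have [->|neq] := eqVneq m k; first by rewrite subrr invr0 !mul0r cos0 sin0 /=; ring.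
by rewrite /=; field; rewrite subr_eq0 eqr_nat.
Qed.

(** The two squares are those of the real and imaginary parts of [p t]; expanding them and using the
    subtraction formulas gives the termwise derivatives. *)
Lemma is_derive_energy u v (t : R) :
  is_derive t 1 (energy u v)
    ((\sum_m (u m * cos (m%:R * t) + v m * sin (m%:R * t))) ^+ 2 +
     (\sum_m (u m * sin (m%:R * t) - v m * cos (m%:R * t))) ^+ 2).
Proof.
suff -> : (\sum_m (u m * cos (m%:R * t) + v m * sin (m%:R * t))) ^+ 2 +
     (\sum_m (u m * sin (m%:R * t) - v m * cos (m%:R * t))) ^+ 2 =
     \sum_(m < N) \sum_(k < N)
       ((u m * u k + v m * v k) * cos ((m%:R - k%:R) * t)
       - (u m * v k - v m * u k) * sin ((m%:R - k%:R) * t)).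
  apply: is_derive_bigsum => m; apply: is_derive_bigsum => k.
  exact: is_derive_energy_term.
rewrite !expr2 !big_distrlr -big_split; apply: eq_bigr => m _.
rewrite -big_split; apply: eq_bigr => k _ /=.
by rewrite !(mulrBl t) cosB sinB; ring.
Qed.

Lemma energy_ndecr u v : {homo energy u v : s t / s <= t}.
Proof.
move=> s t st.
have dE x : derivable (energy u v) x 1.
  by have [] := is_derive_energy u v x.
apply: (@ger0_derive1_ndecr _ (energy u v) s t) => // [x _|].
  have dx := is_derive_energy u v x.
  by rewrite derive1E derive_val addr_ge0// sqr_ge0.
by apply: derivable_within_continuous => x _; exact: dE.
Qed.

(** At [2 pi] the sines vanish and the cosines equal 1, so [(u m * v k - v m * u k) / (m - k)] is
    what remains off the diagonal. *)
Lemma energy_2pi u v : energy u v (2 * pi) =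
  2 * pi * (\sum_m (u m ^+ 2 + v m ^+ 2) +
    \sum_m \sum_k u m * hilbertmx R N m k * v k).
Proof.
set h := \sum_m \sum_k u m * _ * _.
(* Antisymmetry turns [- h] into the form with [u] and [v] exchanged, which matches the coefficients
   of the cosine terms. *)
have -> : \sum_m (u m ^+ 2 + v m ^+ 2) + h =
    \sum_m (u m ^+ 2 + v m ^+ 2) + 2^-1 * (h - - h) by field.
rewrite -hilbert_form_anti -sumrB mulr_sumr -big_split mulr_sumr.
apply: eq_bigr => m _ /=; rewrite -sumrB mulr_sumr [RHS]mulrDr mulr_sumr.
have pi0 : pi != 0 :> R by rewrite gt_eqF ?pi_gt0.
rewrite (bigD1 m)//= [in RHS](bigD1 m)//= addrA; congr (_ + _).
  by rewrite /energy_term !mxE eqxx subrr invr0 /=; ring.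
apply: eq_bigr => k km; rewrite /energy_term !mxE [m == k]eq_sym (negPf km) /=.
rewrite -[(_ - _) * (2 * pi)]addr0 cos_natB2pi sin_natB2pi cos0 sin0.
move: (pi : R) pi0 => p p0.
by field; rewrite p0 subr_eq0 eqr_nat eq_sym km.
Qed.

(** Only the diagonal survives, with weight [2 pi / N * (1 + ... + N)]. Sampling at [j.+1], so that
    [2 pi] is included and 0 is not, is what later yields [1 - 1/N] instead of [1 + 1/N]. *)
Lemma sum_energy_roots u v : (0 < N)%N ->
  \sum_(j < N) energy u v (2 * pi * j.+1%:R / N%:R) =
  pi * (N%:R + 1) * \sum_m (u m ^+ 2 + v m ^+ 2).
Proof.
move=> N_gt0; rewrite exchange_big mulr_sumr; apply: eq_bigr => m _ /=.
have N0 : N%:R != 0 :> R by rewrite pnatr_eq0 -lt0n.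
rewrite exchange_big (bigD1 m)//= [X in _ + X]big1 ?addr0 => [|k km].
  under eq_bigr => j _.
    rewrite /energy_term eqxx subrr invr0 !(mulr0, mul0r, addr0) mul1r.
    over.
  rewrite -mulr_sumr -mulr_suml -mulr_sumr.
  have -> : \sum_(j < N) j.+1%:R = N%:R * (N%:R + 1) / 2 :> R.
    apply: (canRL (mulfK _)); first by rewrite pnatr_eq0.
    elim: {N_gt0 N0 m u v}N => [|n IH]; first by rewrite big_ord0 !mul0r.
    by rewrite big_ord_recr mulrDl IH -natr1; ring.
  by field.
rewrite /energy_term !big_split /= -!mulr_sumr sum_sin_roots// sum_cos_roots//.
  by rewrite [m == k]eq_sym (negPf km) !mul0r !mulr0 !addr0.
by rewrite eq_sym.
Qed.

Lemma hilbert_form_ge u v : (0 < N)%N ->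
  - ((1 - N%:R^-1) * \sum_m (u m ^+ 2 + v m ^+ 2)) <=
  2 * \sum_m \sum_k u m * hilbertmx R N m k * v k.
Proof.
move=> N_gt0; have pi0 := pi_gt0 R.
have N0 : 0 < N%:R :> R by rewrite ltr0n.
have : 0 <= \sum_(j < N) (energy u v (2 * pi) - energy u v (2 * pi * j.+1%:R / N%:R)).
  apply: sumr_ge0 => j _; rewrite subr_ge0; apply: energy_ndecr.
  by rewrite ler_pdivrMr// ler_pM2l ?mulr_gt0// ler_nat.
rewrite sumrB sumr_const card_ord sum_energy_roots// energy_2pi.
rewrite -[X in 0 <= X - _]mulr_natr.
set S := \sum_m (_ + _); set H := \sum_m _ => h.
have E : 2 * pi * (S + H) * N%:R - pi * (N%:R + 1) * S =
  pi * N%:R * (2 * H + (1 - N%:R^-1) * S) by field; rewrite gt_eqF.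
rewrite E in h; rewrite -subr_ge0 opprK.
by move: h; rewrite pmulr_rge0 ?mulr_gt0.
Qed.

(** Duality: the form bound is tested on the pair [(- s * H v, v)], and the scale [s] is then
    optimized. *)
Lemma hilbert_sqnorm_le v : (0 < N)%N ->
  \sum_m (\sum_k hilbertmx R N m k * v k) ^+ 2 <=
  (1 - N%:R^-1) ^+ 2 * \sum_m v m ^+ 2.
Proof.
move=> N_gt0; set d := 1 - N%:R^-1; set V := \sum_m v m ^+ 2.
pose w m := \sum_k hilbertmx R N m k * v k.
rewrite -/(\sum_m w m ^+ 2); set W := \sum_m w m ^+ 2.
have d_ge0 : 0 <= d by rewrite subr_ge0 invf_le1 ?ler1n ?ltr0n.
have h (s : R) : 2 * s * W <= d * (s ^+ 2 * W + V).
  have := hilbert_form_ge (fun m => - s * w m) v N_gt0; rewrite -/d.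
  have -> : \sum_m \sum_k - s * w m * hilbertmx R N m k * v k = - s * W.
    rewrite mulr_sumr; apply: eq_bigr => m _; rewrite expr2 mulrA.
    rewrite [RHS]mulr_sumr.
    by apply: eq_bigr => k _; rewrite mulrA.
  have -> : \sum_m ((- s * w m) ^+ 2 + v m ^+ 2) = s ^+ 2 * W + V.
    by rewrite big_split mulr_sumr; congr (_ + _); apply: eq_bigr => m _; ring.
  by rewrite mulNr mulrN lerN2 mulrA.
have [d0|d_neq0] := eqVneq d 0.
  by have := h 1; rewrite d0 !mul0r expr0n /= mul0r; lra.
(* This [s] maximizes [2 s W - d s^2 W]. *)
have := h d^-1.
have -> : d * (d^-1 ^+ 2 * W + V) = d^-1 * W + d * V by field.
rewrite -subr_ge0 => h1; rewrite -subr_ge0.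
have -> : d ^+ 2 * V - W = d * (d^-1 * W + d * V - 2 * d^-1 * W) by field.
exact: mulr_ge0.
Qed.

End HilbertForm.

(** * Operator norm and condition number from two-sided norm bounds *)

Section OperatorNorm.
Variable R : realType.

Lemma l2norm_ge0 N (x : 'cV[R[i]]_N) : 0 <= l2norm x.
Proof. exact: sqrtr_ge0. Qed.

Lemma normc_sqr (z : R[i]) : Normc.normc z ^+ 2 = complex.Re z ^+ 2 + complex.Im z ^+ 2.
Proof. by case: z => a b /=; rewrite sqr_sqrtr// addr_ge0// sqr_ge0. Qed.

Lemma l2norm_sqr N (x : 'cV[R[i]]_N) :
  l2norm x ^+ 2 = \sum_j (complex.Re (x j 0) ^+ 2 + complex.Im (x j 0) ^+ 2).
Proof.
rewrite sqr_sqrtr; last by apply: sumr_ge0 => j _; rewrite sqr_ge0.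
by apply: eq_bigr => j _; rewrite normc_sqr.
Qed.

Lemma l2norm_eq0 N (x : 'cV[R[i]]_N) : l2norm x = 0 -> x = 0.
Proof.
move=> /eqP; rewrite sqrtr_eq0 => x0; apply/colP => j; rewrite mxE.
apply: Normc.eq0_normc; apply/eqP; rewrite -sqrf_eq0 eq_le sqr_ge0 andbT.
apply: le_trans x0; rewrite (bigD1 j)//= lerDl.
by apply: sumr_ge0 => k _; rewrite sqr_ge0.
Qed.

Lemma opnorm2_ge0 N (A : 'M[R[i]]_N) : 0 <= opnorm2 A.
Proof.
rewrite /opnorm2; set E := (X in sup X).
(* Either the supremum dominates the norm of some image, or it does not exist and [sup] takes its
   default value 0. *)
have [[[y Ey] Eub]|/sup_out ->//] := pselect (has_sup E).
apply: le_trans (ub_le_sup Eub Ey).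
by case: Ey => x _ <-; exact: l2norm_ge0.
Qed.

Lemma opnorm2_le N (A : 'M[R[i]]_N) (b : R) : 0 <= b ->
  (forall x : 'cV_N, l2norm (A *m x) <= b * l2norm x) -> opnorm2 A <= b.
Proof.
move=> b0 Ab; rewrite /opnorm2; set E := (X in sup X).
have [[y Ey]|E0] := pselect (E !=set0)%classic.
  apply: ge_sup; first by exists y.
  by move=> _ [x /= x1 <-]; rewrite (le_trans (Ab x))// x1 mulr1.
(* Without unit vectors [sup] is 0, and [0 <= b] concludes. *)
by rewrite sup_out// => -[].
Qed.

Section BoundedBelow.
Variables (N : nat) (A : 'M[R[i]]_N) (a : R).
Hypotheses (a_gt0 : 0 < a)
  (A_ge : forall x : 'cV_N, a * l2norm x <= l2norm (A *m x)).

(** [A] kills every column of its cokernel matrix, so the lower bound forces these columns to have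
    norm 0. *)
Lemma bounded_below_unitmx : A \in unitmx.
Proof.
rewrite -row_full_unit -cokermx_eq0; apply/eqP/matrixP => i j.
suff /colP/(_ i) : col j (cokermx A) = 0 by rewrite !mxE.
apply: l2norm_eq0; apply/eqP; rewrite eq_le l2norm_ge0 andbT.
rewrite -(pmulr_rle0 _ a_gt0) (le_trans (A_ge _))//.
rewrite colE mulmxA mulmx_coker mul0mx /l2norm big1 ?sqrtr0// => k _.
by rewrite !mxE Normc.normc0 expr0n.
Qed.

(** The lower bound applied to [invmx A *m x] gives [opnorm2 (invmx A) <= 1 / a]. *)
Lemma cond2_le (b : R) : 0 <= b ->
  (forall x : 'cV_N, l2norm (A *m x) <= b * l2norm x) -> cond2 A <= b / a.
Proof.
move=> b_ge0 A_le; apply: ler_pM; rewrite ?opnorm2_ge0 ?opnorm2_le//.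
  by rewrite invr_ge0 ltW.
move=> x; rewrite ler_pdivlMl// (le_trans (A_ge _))//.
by rewrite mulmxA mulmxV ?mul1mx// bounded_below_unitmx.
Qed.
End BoundedBelow.
End OperatorNorm.

(** * Two-sided norm bounds for [c - iH] *)

Section ShiftedHilbert.
Variables (R : realType) (N : nat) (c : R) (x : 'cV[R[i]]_N).
Hypothesis N_gt0 : (0 < N)%N.
Let d : R := 1 - N%:R^-1.
Let u j : R := complex.Re (x j 0).
Let v j : R := complex.Im (x j 0).
Let H (w : 'I_N -> R) m : R := \sum_k hilbertmx R N m k * w k.

Lemma shifted_hilbert_coord j :
  (shifted_hilbertmx N c *m x) j 0 = Complex (c * u j + H v j) (c * v j - H u j).
Proof.
rewrite /shifted_hilbertmx mulmxBl mul_scalar_mx -scalemxAl !mxE.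
have -> : \sum_k map_mx (real_complex R) (hilbertmx R N) j k * x k 0 =
    Complex (H u j) (H v j).
  rewrite /H; elim/big_rec3: _ => // k p q r _ ->.
  rewrite mxE /u /v; case: (x k 0) => p' q' /=; rewrite /real_complex_def.
  by apply/eqP; rewrite eq_complex /= !mul0r subr0 addr0 !eqxx.
rewrite /u /v; case: (x j 0) => p q; apply/eqP; rewrite eq_complex /=.
by apply/andP; split; apply/eqP; ring.
Qed.

Lemma shifted_hilbert_sqnorm : l2norm (shifted_hilbertmx N c *m x) ^+ 2 =
  \sum_j ((c * u j + H v j) ^+ 2 + (c * v j - H u j) ^+ 2).
Proof. by rewrite l2norm_sqr; apply: eq_bigr => j _; rewrite shifted_hilbert_coord. Qed.

Let S : R := \sum_j (u j ^+ 2 + v j ^+ 2).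
Let Q : R := \sum_j (u j * H v j - v j * H u j).

(** [Q] is the Hermitian form [<x, -iHx>] in real coordinates. Exchanging [u] and [v] reverses its
    sign, so the one-sided bound gives both sides. *)
Lemma hilbert_hermitian_form_bounds : - (d * S) <= Q <= d * S.
Proof.
have form w w' : \sum_j w j * H w' j = \sum_m \sum_k w m * hilbertmx R N m k * w' k.
  apply: eq_bigr => m _; rewrite mulr_sumr.
  by apply: eq_bigr => k _; rewrite mulrA.
have QE : Q = 2 * \sum_m \sum_k u m * hilbertmx R N m k * v k.
  by rewrite /Q sumrB !form (hilbert_form_anti R N u v) opprK -mulr2n mulr_natl.
apply/andP; split; first by rewrite QE; exact: hilbert_form_ge.
have := hilbert_form_ge R N v u N_gt0.
rewrite (hilbert_form_anti R N u v) mulrN -QE lerN2.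
by rewrite /S; under eq_bigr do rewrite addrC.
Qed.

Lemma shifted_hilbert_bounds : 0 <= d -> d < c ->
  (c - d) * l2norm x <= l2norm (shifted_hilbertmx N c *m x) <= (c + d) * l2norm x.
Proof.
move=> d_ge0 dc; have /andP[Q_ge Q_le] := hilbert_hermitian_form_bounds.
have e_gt0 : 0 < c - d by rewrite subr_gt0.
have c_gt0 : 0 < c by apply: le_lt_trans dc.
have S_E : l2norm x ^+ 2 = S by exact: l2norm_sqr.
have f_ge0 : 0 <= c + d by rewrite addr_ge0 ?(ltW c_gt0).
have sqr_le (p q : R) : 0 <= p -> 0 <= q -> p ^+ 2 <= q ^+ 2 -> p <= q.
  by move=> p0 q0; rewrite ler_sqr.
apply/andP; split; apply: sqr_le;
  rewrite ?mulr_ge0 ?l2norm_ge0 ?(ltW e_gt0)// exprMn shifted_hilbert_sqnorm S_E.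
- (* |y|^2 >= 2 e Re <x, y> - e^2 |x|^2, with e = c - d and y = (c - iH) x *)
  have h : 0 <= \sum_j ((c * u j + H v j - (c - d) * u j) ^+ 2 +
                        (c * v j - H u j - (c - d) * v j) ^+ 2).
    by apply: sumr_ge0 => j _; rewrite addr_ge0// sqr_ge0.
  suff E : \sum_j ((c * u j + H v j) ^+ 2 + (c * v j - H u j) ^+ 2) =
      \sum_j ((c * u j + H v j - (c - d) * u j) ^+ 2 +
              (c * v j - H u j - (c - d) * v j) ^+ 2)
      + 2 * (c - d) * (c * S + Q) - (c - d) ^+ 2 * S.
    (* Here [c * S + Q] is [Re <x, y>]; this makes it at least [e S], leaving
       [2 e^2 S - e^2 S = e^2 S]. *)
    have h2 : 0 <= (c - d) * (Q + d * S).
      by apply: mulr_ge0; [exact: ltW | rewrite -lerBlDr sub0r].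
    rewrite E; nra.
  rewrite /S /Q [c * _]mulr_sumr -[X in _ + _ * X]big_split !mulr_sumr -big_split.
  rewrite -sumrB /=.
  by apply: eq_bigr => j _; ring.
(* The last bracket is [|Hx|^2]. With [Q <= d S] and [|Hx|^2 <= d^2 S] the whole is at most
   [(c + d)^2 S]. *)
- have E : \sum_j ((c * u j + H v j) ^+ 2 + (c * v j - H u j) ^+ 2) =
      c ^+ 2 * S + 2 * c * Q + (\sum_j H u j ^+ 2 + \sum_j H v j ^+ 2).
    rewrite /S /Q !mulr_sumr -!big_split/=; apply: eq_bigr => j _; ring.
  have hK : \sum_j H u j ^+ 2 + \sum_j H v j ^+ 2 <= d ^+ 2 * S.
    by rewrite /S big_split mulrDr lerD// hilbert_sqnorm_le.
  have h2 : 0 <= c * (d * S - Q) by apply: mulr_ge0; [exact: ltW | rewrite subr_ge0].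
  rewrite E; nra.
Qed.

End ShiftedHilbert.

(** The quotient is [(c + d) / (c - d)] with [c = 1 + eps] and [d = 1 - 1/N]. Its denominator
    [eps + 1/N] stays positive at [eps = 0], so both cases of the theorem are covered. *)
Lemma shifted_hilbert_unitmx_cond2 (R : realType) (N : nat) (eps : R) :
  (0 < N)%N -> 0 <= eps ->
  shifted_hilbertmx N (1 + eps) \in unitmx /\
  cond2 (shifted_hilbertmx N (1 + eps)) <=
    (2 + eps - N%:R^-1) / (eps + N%:R^-1).
Proof.
move=> N_gt0 eps_ge0; have N0 : 0 < N%:R^-1 :> R by rewrite invr_gt0 ltr0n.
have N1 : N%:R^-1 <= 1 :> R by rewrite invf_le1 ?ler1n ?ltr0n.
have -> : eps + N%:R^-1 = 1 + eps - (1 - N%:R^-1) by ring.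
have -> : 2 + eps - N%:R^-1 = 1 + eps + (1 - N%:R^-1) by ring.
have a_gt0 : 0 < 1 + eps - (1 - N%:R^-1) by lra.
have bounds (x : 'cV[R[i]]_N) :
    (1 + eps - (1 - N%:R^-1)) * l2norm x <=
      l2norm (shifted_hilbertmx N (1 + eps) *m x) <=
    (1 + eps + (1 - N%:R^-1)) * l2norm x.
  by apply: shifted_hilbert_bounds => //; lra.
have A_ge x := proj1 (andP (bounds x)); have A_le x := proj2 (andP (bounds x)).
split; first exact: bounded_below_unitmx A_ge.
by apply: cond2_le => //; lra.
Qed.

Theorem mainTheorem1 (R : realType) :
  [/\ forall N : nat, (0 < N)%N ->
        shifted_hilbertmx N (1 : R) \in unitmx /\
        cond2 (shifted_hilbertmx N (1 : R)) <= 2 * N%:R - 1,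
      forall (N : nat) (eps : R), (0 < N)%N -> 0 < eps ->
        [/\ shifted_hilbertmx N (1 + eps) \in unitmx,
            cond2 (shifted_hilbertmx N (1 + eps))
              <= (2 + eps - N%:R^-1) / (eps + N%:R^-1) &
            (2 + eps - N%:R^-1) / (eps + N%:R^-1) <= (2 + eps) / eps],
      exists C : R, forall N : nat, (0 < N)%N ->
        cond2 (shifted_hilbertmx N (1 : R)) <= C * N%:R &
      forall eps : R, 0 < eps ->
        exists C : R, forall N : nat, (0 < N)%N ->
          cond2 (shifted_hilbertmx N (1 + eps)) <= C].
Proof.
have unshifted N : (0 < N)%N ->
    shifted_hilbertmx N (1 : R) \in unitmx /\
    cond2 (shifted_hilbertmx N (1 : R)) <= 2 * N%:R - 1.
  move=> N_gt0; have := shifted_hilbert_unitmx_cond2 R N 0 N_gt0 (lexx _).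
  rewrite !addr0 add0r invrK.
  suff -> : (2 - N%:R^-1) * N%:R = 2 * N%:R - 1 :> R by [].
  by rewrite mulrBl mulVf// pnatr_eq0 -lt0n.
have shifted_le (N : nat) (eps : R) : (0 < N)%N -> 0 < eps ->
    (2 + eps - N%:R^-1) / (eps + N%:R^-1) <= (2 + eps) / eps.
  move=> N_gt0 eps_gt0; have N0 : 0 < N%:R^-1 :> R by rewrite invr_gt0 ltr0n.
  rewrite ler_pdivrMr ?addr_gt0// mulrAC ler_pdivlMr//.
  (* After clearing denominators the two sides differ by [N^-1 * (2 + 2 * eps)]. *)
  by nra.
split=> // [N eps N_gt0 eps_gt0||eps eps_gt0].
- have [? ?] := shifted_hilbert_unitmx_cond2 R N eps N_gt0 (ltW eps_gt0).
  by split=> //; exact: shifted_le.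
- exists 2 => N /unshifted[_ /le_trans]; apply.
  by rewrite gerBl.
- exists ((2 + eps) / eps) => N N_gt0.
  have [_ h] := shifted_hilbert_unitmx_cond2 R N eps N_gt0 (ltW eps_gt0).
  exact: le_trans h (shifted_le _ _ N_gt0 eps_gt0).
Qed.
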